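(* Let $L_1$ and $L_2$ be finite-dimensional Lie algebras over a finite field $F$ such that $G_{L_1}\cong G_{L_2}$ as graphs. If there is a vertex $x\in V(G_{L_1})$ such that $\deg(x)=p^{n}q$, where $p$ and $q$ are prime numbers, $p>q$ and $n\geq 1$, then $|L_1|=|L_2|$.
   Context: For a Lie algebra $L$, $Z(L)=\{x\in L : [x,y]=0 \text{ for all } y\in L\}$ is its centre. The non-commuting graph $G_L$ is the undirected simple graph with vertex set $V(G_L)=L\setminus Z(L)$, in which two distinct vertices $x$ and $y$ are adjacent if and only if $[x,y]\neq 0$. The degree $\deg(x)$ is the number of edges incident to $x$, and $|L|$ is the number of elements of $L$. *)

(* Defs.v *)
From HB Require Import structures.
From mathcomp Require Import all_boot all_algebra finfield.

Set Implicit Arguments.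
Unset Strict Implicit.
Unset Printing Implicit Defensive.

Import GRing.Theory.
Local Open Scope ring_scope.

(* [x, x] = 0 is imposed rather than antisymmetry, as F may have
   characteristic 2. *)
HB.mixin Record Lmodule_isLieAlgebra (F : fieldType) L of GRing.Lmodule F L := {
  lie : L -> L -> L;
  lie_linearl : forall y, linear (fun x => lie x y);
  lie_linearr : forall x, linear (lie x);
  liexx : forall x, lie x x = 0;
  lie_jacobi : forall x y z,
    lie x (lie y z) + lie y (lie z x) + lie z (lie x y) = 0
}.

#[short(type="lieAlgType")]
HB.structure Definition LieAlgebra (F : fieldType) :=
  { L of Lmodule_isLieAlgebra F L & GRing.Lmodule F L }.

#[short(type="finDimLieAlgType")]
HB.structure Definition FinDimLieAlgebra (F : fieldType) :=
  { L of LieAlgebra F L & Vector F L }.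

Record sgraph := SGraph {
  vertex :> finType;
  adj : rel vertex;
  adj_sym : symmetric adj;
  adj_irrefl : irreflexive adj
}.

Definition edges (G : sgraph) : {set {set G}} :=
  [set e : {set G} | [exists x, exists y, adj x y && (e == [set x; y])]].

Definition deg (G : sgraph) (x : G) : nat := #|[set e in edges G | x \in e]|.

Definition sgraph_iso (G H : sgraph) : Prop :=
  exists2 f : G -> H, bijective f & {mono f : x y / adj x y}.

Section NonCommutingGraph.
Variables (F : finFieldType) (L : finDimLieAlgType F).

(* finvect_type L is L itself, with the finType structure it gets from F. *)
Definition lie_centre : {set finvect_type L} :=
  [set x : finvect_type L | [forall y : finvect_type L, lie (x : L) (y : L) == 0]].

Definition nc_vertex : finType := {x : finvect_type L | x \notin lie_centre}.

Definition nc_adj : rel nc_vertex :=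
  fun x y => (x != y) && (lie (val x : L) (val y : L) != 0).

Lemma lie_anti (x y : L) : lie y x = - lie x y.
Proof.
have addl (a b c : L) : lie (a + b) c = lie a c + lie b c.
  by have := lie_linearl c 1 a b; rewrite !scale1r.
have addr (a b c : L) : lie a (b + c) = lie a b + lie a c.
  by have := lie_linearr a 1 b c; rewrite !scale1r.
have := liexx (x + y); rewrite addl !addr !liexx add0r addr0 => /eqP.
by rewrite addrC addr_eq0 => /eqP.
Qed.

Lemma nc_adj_sym : symmetric nc_adj.
Proof. by move=> x y; rewrite /nc_adj eq_sym lie_anti oppr_eq0. Qed.

Lemma nc_adj_irrefl : irreflexive nc_adj.
Proof. by move=> x; rewrite /nc_adj eqxx. Qed.

Definition nc_graph : sgraph := SGraph nc_adj_sym nc_adj_irrefl.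

End NonCommutingGraph.

(* Main.v *)
Require Import Defs.
From HB Require Import structures.
From mathcomp Require Import all_boot all_algebra finfield.

Set Implicit Arguments.
Unset Strict Implicit.
Unset Printing Implicit Defensive.

(** Write Q for the order of F. The centre of a Lie algebra L is a subspace
    ([card_lie_centre]), so the graph of L has

      Q ^ dim L - Q ^ dim Z(L) = Q ^ dim Z(L) * (Q ^ (dim L - dim Z(L)) - 1)

    vertices. As soon as there is a vertex, dim Z(L) < dim L, so the second
    factor is prime to Q: the number of vertices determines dim Z(L), as the
    exponent of the largest power of Q dividing it, and then dim L
    ([expn_difference_inj]). Isomorphic graphs have the same number of
    vertices, and both algebras are over the same F. *)

(** The equation says Q ^ a - Q ^ b = Q ^ c - Q ^ d, in a form that avoids
    truncated subtraction. The exact power of Q dividing the left side is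
    Q ^ b, and Q ^ d for the right side, so that b = d. *)
Lemma expn_difference_inj (Q a b c d : nat) :
  1 < Q -> b < a -> d < c -> Q ^ a + Q ^ d = Q ^ c + Q ^ b -> a = c.
Proof.
move=> Q_gt1.
wlog le_bd : a b c d / b <= d => [hwlog | ] lt_ba lt_dc eqQ.
  (* The equation is invariant under exchanging (a, b) and (c, d). *)
  have [/hwlog | /ltnW/hwlog] := leqP b d; first exact.
  by move=> h; apply/esym/h.
have eq_bd : b = d.
  apply/eqP; rewrite eqn_leq le_bd leqNgt; apply/negP => lt_bd.
  have dvdQ m : b < m -> Q ^ b.+1 %| Q ^ m by apply: dvdn_exp2l.
  have : Q ^ b.+1 %| Q ^ c + Q ^ b.
    by rewrite -eqQ dvdn_add ?dvdQ.
  by rewrite dvdn_addr ?(dvdQ c (ltn_trans lt_bd lt_dc)) // dvdn_Pexp2l ?ltnn.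
by move: eqQ; rewrite eq_bd => /addIn/eqP; rewrite eqn_exp2l // => /eqP.
Qed.

Section Centre.
Local Open Scope ring_scope.
Variables (F : finFieldType) (L : finDimLieAlgType F).

(** A named form of the bracket as a function of its left argument, to which a
    linear structure can be attached. *)
Definition lie_right (y x : L) : L := lie x y.

HB.instance Definition _ (y : L) :=
  GRing.isLinear.Build F L L *:%R (lie_right y) (lie_linearl y).

(** The centre as an intersection of kernels of linear maps: this form carries
    the dimension that the set [lie_centre L] lacks. *)
Definition centre_vspace : {vspace finvect_type L} :=
  (\bigcap_(y : finvect_type L) lker (linfun (lie_right y)))%VS.

Lemma mem_centre_vspace (x : finvect_type L) :
  (x \in lie_centre L) = (x \in centre_vspace).
Proof.
rewrite inE [RHS]memvE; apply/forallP/subv_bigcapP => /= h y.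
  by move=> _; rewrite -memvE memv_ker lfunE; apply: h.
by have := h y isT; rewrite -memvE memv_ker lfunE.
Qed.

Lemma card_lie_centre : #|lie_centre L| = (#|F| ^ \dim centre_vspace)%N.
Proof. by rewrite -card_vspace; apply: eq_card => x; apply: mem_centre_vspace. Qed.

Lemma card_lie_alg : #|finvect_type L| = (#|F| ^ \dim {:finvect_type L})%N.
Proof. by rewrite -card_vspace; apply: eq_card => x; rewrite memvf. Qed.

Lemma card_nc_graph : (#|nc_graph L| + #|lie_centre L|)%N = #|finvect_type L|.
Proof. by rewrite card_sig addnC -[RHS](cardC (mem (lie_centre L))). Qed.

Lemma dim_centre_lt : nc_graph L -> (\dim centre_vspace < \dim {:finvect_type L})%N.
Proof.
move=> x; rewrite -(ltn_exp2l _ _ (finNzRing_gt1 F)) -card_lie_centre -card_lie_alg.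
rewrite -card_nc_graph -[ltnLHS]add0n ltn_add2r.
by apply/card_gt0P; exists x.
Qed.

End Centre.

Theorem corollary4p5 (F : finFieldType) (L1 L2 : finDimLieAlgType F)
    (hG : sgraph_iso (nc_graph L1) (nc_graph L2))
    (x : nc_graph L1) (p q n : nat)
    (hp : prime p) (hq : prime q) (hqp : q < p) (hn : 1 <= n)
    (hdeg : deg x = p ^ n * q) :
  #|finvect_type L1| = #|finvect_type L2|.
Proof.
case: hG => f f_bij _.
rewrite !card_lie_alg; congr (_ ^ _).
apply: (expn_difference_inj (finNzRing_gt1 F) (dim_centre_lt x)
                            (dim_centre_lt (f x))).
rewrite -!card_lie_alg -!card_lie_centre -!card_nc_graph (bij_eq_card f_bij).
by rewrite addnAC.
Qed.
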